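(* Let $p$ be an odd prime, $\Bbbk$ a field of characteristic $p$, $G=\langle\sigma\rangle$ of order $p$ acting on $V=V_3$ with $\sigma x_1=x_1+x_2$, $\sigma x_2=x_2+x_3$, $\sigma x_3=x_3$ on the dual basis, $A=\Bbbk[x_3,\ x_2^2-2x_1x_3-x_2x_3,\ \prod_{i=0}^{p-1}\sigma^i(x_1)]$, and $1\le n\le p$. For $i=0,\dots,n-1$ define \[M_i=\begin{cases}x_1^{i/2}& i\text{ even},\\ x_1^{(i-1)/2}x_2 & i\text{ odd},\end{cases}\qquad P_i=\begin{cases}x_1^{p-1}x_2 & i=0,\\ \Delta(x_1^{p-i/2}) & i \text{ even},\ i>0,\\ x_1^{p-(i+1)/2} & i\text{ odd}.\end{cases}\] Then $K_n=\ker(\Delta^n:\Bbbk[V]\to\Bbbk[V])$ is a free $A$-module with basis \[S_n=\{M_0,M_1,\dots,M_{n-1},\ \Delta^{p-n}(P_0),\Delta^{p-n}(P_1),\dots,\Delta^{p-n}(P_{n-1})\}.\]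
   Context: $\Delta=\sigma-\iota\in\Bbbk G$ acting on $\Bbbk[V]=\Bbbk[x_1,x_2,x_3]$. *)

(* Defs.v *)
From HB Require Import structures.
From mathcomp Require Import all_boot all_order all_algebra.
From mathcomp Require Import mpoly.
Set Implicit Arguments. Unset Strict Implicit. Unset Printing Implicit Defensive.
Import GRing.Theory.
Local Open Scope ring_scope.

Section Defs.
Variable k : fieldType.
Notation poly3 := {mpoly k[3]}.

Definition x1 : poly3 := 'X_(@Ordinal 3 0 isT).
Definition x2 : poly3 := 'X_(@Ordinal 3 1 isT).
Definition x3 : poly3 := 'X_(@Ordinal 3 2 isT).

Definition sigma (f : poly3) : poly3 :=
  comp_mpoly [tuple x1 + x2; x2 + x3; x3] f.

Definition Delta (f : poly3) : poly3 := sigma f - f.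

Definition DeltaN (m : nat) (f : poly3) : poly3 := iter m Delta f.

Definition Kker (n : nat) : pred poly3 := fun f => DeltaN n f == 0.

Definition Nx1 (p : nat) : poly3 := \prod_(i < p) iter i sigma x1.
Definition gensA (p : nat) : 3.-tuple poly3 :=
  [tuple x3; x2 ^+ 2 - 2%:R * x1 * x3 - x2 * x3; Nx1 p].

(* A = k[x3, x2^2 - 2 x1 x3 - x2 x3, N(x1)] as the image of k[y1,y2,y3] *)
Definition inA (p : nat) (a : poly3) : Prop :=
  exists q : poly3, a = comp_mpoly (gensA p) q.

Definition Mi (i : nat) : poly3 :=
  if ~~ odd i then x1 ^+ i./2 else x1 ^+ i./2 * x2.

Definition Pi (p i : nat) : poly3 :=
  if i == 0%N then x1 ^+ p.-1 * x2
  else if ~~ odd i then Delta (x1 ^+ (p - i./2))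
  else x1 ^+ (p - (i.+1)./2).
End Defs.

(* Main.v *)
Require Import Defs.
From HB Require Import structures.
From mathcomp Require Import all_boot all_order all_algebra.
From mathcomp Require Import mpoly.
From mathcomp Require Import zify ring.
Import GRing.Theory.
Local Open Scope ring_scope.
Set Implicit Arguments. Unset Strict Implicit. Unset Printing Implicit Defensive.

(** Write [d = x2^2 - 2 x1 x3 - x2 x3].  After inverting [x3] the ring [k[V]] is
    [k[x3, d, t]] with [t = x2], on which [sigma] is [t -> t + x3] and fixes [x3] and
    [d].  There [Delta] is a difference operator, so a polynomial killed by
    [Delta^n] has degree [< n] modulo [p] in [t].  The elements of [S_n] have
    degrees [0, ..., n-1] and [p, ..., p+n-1], and [N(x1)] has degree [2p]; cancelling
    leading terms puts [x3^E f] in the [A]-span of [S_n] for every [f] in [K_n].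

    Modulo [x3] the ring is [k[x1, x2]], free over [k[x2^2, N(x1)]] on the
    [x1^i x2^e] with [i < p] and [e < 2].  The leading terms in [x1] of the elements
    of [S_n] are pairwise distinct members of this basis up to even powers of [x2],
    so [S_n] is linearly independent modulo [x3].  Hence its [A]-span is saturated
    with respect to [x3], which removes the factor [x3^E], and [S_n] is linearly
    independent over [A]. *)

(** * Difference operators on univariate polynomials *)

Section Difference.
Variables (S : idomainType) (c : S).
Implicit Types G H : {poly S}.

Definition pdelta G := G \Po ('X + c%:P) - G.

Lemma pdeltaB : {morph pdelta : G H / G - H}.
Proof. by move=> G H; rewrite /pdelta raddfB /=; ring. Qed.

Lemma pdeltaCM a G : pdelta (a%:P * G) = a%:P * pdelta G.
Proof. by rewrite /pdelta comp_polyM comp_polyC mulrBr. Qed.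

Lemma iter_pdeltaB m : {morph iter m pdelta : G H / G - H}.
Proof. by move=> G H; elim: m => //= m ->; rewrite pdeltaB. Qed.

Lemma iter_pdeltaCM m a G : iter m pdelta (a%:P * G) = a%:P * iter m pdelta G.
Proof. by elim: m => //= m ->; rewrite pdeltaCM. Qed.

Lemma size_shift G : size (G \Po ('X + c%:P)) = size G.
Proof. by rewrite size_comp_poly2 // size_XaddC. Qed.

Lemma lead_coef_shift G : lead_coef (G \Po ('X + c%:P)) = lead_coef G.
Proof.
rewrite lead_coef_comp ?size_XaddC //.
by rewrite -[c%:P]opprK -polyCN lead_coefXsubC expr1n mulr1.
Qed.

Lemma coef_shift_lead G m : (size G <= m.+1)%N -> (G \Po ('X + c%:P))`_m = G`_m.
Proof.
rewrite leq_eqVlt ltnS => /orP[/eqP sG | sG].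
  by have := lead_coef_shift G; rewrite !lead_coefE size_shift sG.
by rewrite !nth_default // size_shift.
Qed.

(** The second term of the binomial [('X + c)^(m.+1)] is the only new contribution in degree [m]; it
    becomes the leading coefficient of [pdelta G]. *)
Lemma coef_shift_sublead G m : (size G <= m.+2)%N ->
  (G \Po ('X + c%:P))`_m = G`_m + m.+1%:R * c * G`_m.+1.
Proof.
elim/poly_ind: G m => [|G a IH] m sG.
  by rewrite comp_poly0 !coef0 mulr0 addr0.
have sG1 : (size G <= m.+1)%N.
  have [->|G0] := eqVneq G 0; first by rewrite size_poly0.
  by move: sG; rewrite size_MXaddC (negPf G0).
rewrite comp_polyD comp_polyM comp_polyX comp_polyC mulrDr !coefD coefMC !coefMX !coefC.
rewrite (coef_shift_lead sG1); case: m sG1 {sG} => [|m] sG1 /=; first by ring.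
by rewrite IH // (natrD _ 1 m.+1); ring.
Qed.

Lemma size_pdelta_le G : (size (pdelta G) <= (size G).-1)%N.
Proof.
apply/leq_sizeP => j Gj; rewrite /pdelta coefB coef_shift_lead ?subrr //.
by case: (size G) Gj.
Qed.

Lemma iter_pdelta_eq0 m G : (size G <= m)%N -> iter m pdelta G = 0.
Proof.
elim: m G => [|m IH] G sG; first by apply/eqP; rewrite -size_poly_eq0 -leqn0.
rewrite iterSr IH // (leq_trans (size_pdelta_le G)) //.
by case: (size G) sG.
Qed.

(** The leading coefficient is tracked only up to units: a difference multiplies it by [c] and by an
    integer, a unit when prime to [p]. Below, [c] stands for [x3] in the localized ring and for [x2]
    modulo [x3]. *)
Definition lterm r e G :=
  size G = r.+1 /\ exists2 u, u \is a GRing.unit & lead_coef G = u * c ^+ e.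

Lemma lterm_neq0 r e G : lterm r e G -> G != 0.
Proof. by case=> sG _; rewrite -size_poly_eq0 sG. Qed.

Lemma lterm_mul r e r' e' G H :
  lterm r e G -> lterm r' e' H -> lterm (r + r') (e + e') (G * H).
Proof.
move=> LG LH; have G0 := lterm_neq0 LG; have H0 := lterm_neq0 LH.
case: LG LH => sG [u uu lG] [sH [v uv lH]]; split.
  by rewrite size_mul // sG sH addnS.
exists (u * v); first by rewrite unitrM uu.
by rewrite lead_coefM lG lH exprD; ring.
Qed.

Lemma lterm1 : lterm 0 0 1.
Proof.
split; first by rewrite size_poly1.
by exists 1; rewrite ?unitr1 // lead_coef1 mulr1.
Qed.

Lemma lterm_exp r e G m : lterm r e G -> lterm (r * m) (e * m) (G ^+ m).
Proof.
move=> LG; elim: m => [|m IH]; first by rewrite !muln0; apply: lterm1.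
by rewrite exprS !mulnS; apply: lterm_mul.
Qed.

Lemma ltermX : lterm 1 0 'X.
Proof.
split; first by rewrite size_polyX.
by exists 1; rewrite ?unitr1 // lead_coefX mulr1.
Qed.

Lemma lterm_shift r e G : lterm r e G -> lterm r e (G \Po ('X + c%:P)).
Proof. by rewrite /lterm size_shift lead_coef_shift. Qed.

Definition lcancel a b G H := a%:P * G - b%:P * H.

Lemma iter_pdelta_lcancel m a b G H :
  iter m pdelta (lcancel a b G H) =
  lcancel a b (iter m pdelta G) (iter m pdelta H).
Proof. by rewrite iter_pdeltaB !iter_pdeltaCM. Qed.

Lemma size_lcancel d a b G H : size G = d.+1 -> size H = d.+1 ->
  a * lead_coef G = b * lead_coef H -> (size (lcancel a b G H) <= d)%N.
Proof.
rewrite !lead_coefE => sG sH; rewrite sG sH /= => e; apply/leq_sizeP => j.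
rewrite leq_eqVlt coefB !coefCM => /orP[/eqP <-|dj]; first by rewrite e subrr.
by rewrite !nth_default ?sG ?sH // !mulr0 subrr.
Qed.

Hypothesis c_neq0 : c != 0.
Variable p : nat.
Hypothesis unit_nat : forall m, ~~ (p %| m)%N -> (m%:R : S) \is a GRing.unit.

Lemma coef_pdelta_lead r G :
  size G = r.+2 -> (pdelta G)`_r = r.+1%:R * c * lead_coef G.
Proof.
move=> sG; rewrite /pdelta coefB coef_shift_sublead ?sG // lead_coefE sG /=; ring.
Qed.

Lemma size_pdelta r G : ~~ (p %| r.+1)%N -> size G = r.+2 -> size (pdelta G) = r.+1.
Proof.
move=> pr sG; apply/eqP; rewrite eqn_leq -{1}[r.+1]/(r.+2.-1) -sG size_pdelta_le /=.
have G0 : G != 0 by rewrite -size_poly_eq0 sG.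
rewrite ltnNge; apply/negP => /leq_sizeP/(_ r (leqnn r))/eqP.
rewrite coef_pdelta_lead // !mulf_eq0 lead_coef_eq0 (negPf G0) (negPf c_neq0) !orbF.
by move=> r0; have := unit_nat pr; rewrite (eqP r0) unitr0.
Qed.

Lemma lterm_pdelta r e G :
  ~~ (p %| r.+1)%N -> lterm r.+1 e G -> lterm r e.+1 (pdelta G).
Proof.
move=> pr [sG [u uu lG]]; split; first exact: size_pdelta.
exists (r.+1%:R * u); first by rewrite unitrM unit_nat.
by rewrite lead_coefE (size_pdelta pr sG) coef_pdelta_lead // lG exprS; ring.
Qed.

Lemma lterm_iter_pdelta m r e G :
    (forall j, r < j <= r + m -> ~~ (p %| j))%N ->
  lterm (r + m) e G -> lterm r (e + m) (iter m pdelta G).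
Proof.
elim: m r e G => [|m IH] r e G pr LG; first by rewrite !addn0 in LG *.
rewrite iterSr addnS -addSn; apply: IH => [j /andP[rj jm]|].
  by apply: pr; rewrite rj (leq_trans jm) // leq_add2l.
rewrite addnS in LG; apply: lterm_pdelta LG; apply: pr; lia.
Qed.

(** Each difference lowers the degree by exactly one until a multiple of [p] is reached, so [G]
    stays nonzero through [r %% p] differences. *)
Lemma ker_pdelta_degree n r G : (n <= p)%N ->
  size G = r.+1 -> iter n pdelta G = 0 -> (r %% p < n)%N.
Proof.
elim: n r G => [|n IH] r G np sG; first by move=> /= G0; rewrite G0 size_poly0 in sG.
rewrite iterSr => dG; have [/eqP-> //|pr] := boolP (p %| r)%N.
case: r => [|r] in sG pr *; first by rewrite dvdn0 in pr.
have := IH r (pdelta G) (ltnW np) (size_pdelta pr sG) dG.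
(* Since [r %% p < n < p], adding one does not wrap around modulo [p]. *)
rewrite -[r.+1]addn1 -modnDml => rn; rewrite modn_small; first by rewrite addn1.
by rewrite addn1 (leq_trans _ np).
Qed.

End Difference.

(** * Evaluation of polynomials along a ring morphism *)

Section PolyEval.
Variables (A : nzRingType) (B : comNzRingType) (f : {rmorphism A -> B}) (u : B).

Definition polyev : {poly A} -> B := horner_morph (fun a => mulrC u (f a)).

HB.instance Definition _ := GRing.RMorphism.on polyev.

Lemma polyevC a : polyev a%:P = f a. Proof. exact: horner_morphC. Qed.
Lemma polyevX : polyev 'X = u. Proof. exact: horner_morphX. Qed.

End PolyEval.

Lemma polyev_lcancel (S : idomainType) (B : comNzRingType)
    (f : {rmorphism S -> B}) (u : B) (a b : S) (G H : {poly S}) :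
  polyev f u (lcancel a b G H) = f a * polyev f u G - f b * polyev f u H.
Proof. by rewrite /lcancel rmorphB !rmorphM /= !polyevC. Qed.

(** * The action of sigma *)

Section Setup.
Variable k : fieldType.
Notation poly3 := {mpoly k[3]}.
Notation x1 := (x1 k).
Notation x2 := (x2 k).
Notation x3 := (x3 k).
Implicit Types f g h : poly3.

Lemma mpoly3_ind (P : poly3 -> Prop) :
  (forall a, P a%:MP) -> P x1 -> P x2 -> P x3 ->
  (forall f g, P f -> P g -> P (f + g)) ->
  (forall f g, P f -> P g -> P (f * g)) -> forall f, P f.
Proof.
move=> PC P1 P2 P3 PD PM.
have PX i : P 'X_i.
  case: i => [[|[|[|//]]] i3].
  - by rewrite (_ : Ordinal i3 = @Ordinal 3 0 isT) //; apply: val_inj.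
  - by rewrite (_ : Ordinal i3 = @Ordinal 3 1 isT) //; apply: val_inj.
  - by rewrite (_ : Ordinal i3 = @Ordinal 3 2 isT) //; apply: val_inj.
apply: mpolyind => [|a m f _ _ Pf]; first by rewrite -mpolyC0.
apply: PD => //; rewrite -mul_mpolyC; apply: (PM) => //.
rewrite mpolyXE_id; apply: (big_ind P) => [|f1 f2|i _]; [by rewrite -mpolyC1|exact: PM|].
elim: (m i) => [|e IH]; first by rewrite expr0 -mpolyC1.
by rewrite exprS; apply: PM.
Qed.

Lemma rmorph3_ext (B : nzRingType) (g h : {rmorphism poly3 -> B}) :
  (forall a, g a%:MP = h a%:MP) -> g x1 = h x1 -> g x2 = h x2 -> g x3 = h x3 -> g =1 h.
Proof.
move=> gC g1 g2 g3; apply: mpoly3_ind => // [f f' e e'|f f' e e'].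
  by rewrite !rmorphD e e'.
by rewrite !rmorphM e e'.
Qed.

HB.instance Definition _ := GRing.RMorphism.copy (@sigma k)
  (comp_mpoly [tuple x1 + x2; x2 + x3; x3]).

Lemma sigma_x1 : sigma x1 = x1 + x2. Proof. exact: comp_mpolyXU. Qed.
Lemma sigma_x2 : sigma x2 = x2 + x3. Proof. exact: comp_mpolyXU. Qed.
Lemma sigma_x3 : sigma x3 = x3. Proof. exact: comp_mpolyXU. Qed.
Lemma sigmaC a : sigma a%:MP = a%:MP :> poly3. Proof. exact: comp_mpolyC. Qed.

Lemma x3_neq0 : x3 != 0.
Proof. by rewrite -msupp_eq0 msuppX. Qed.

Lemma DeltaM_inv f g : sigma f = f -> Delta (f * g) = f * Delta g.
Proof. by move=> sf; rewrite /Delta rmorphM /= sf mulrBr. Qed.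

Lemma DeltaN_inv m f g : sigma f = f -> DeltaN m (f * g) = f * DeltaN m g.
Proof. by move=> sf; rewrite /DeltaN; elim: m => //= m ->; rewrite DeltaM_inv. Qed.

Definition dd : poly3 := x2 ^+ 2 - 2%:R * x1 * x3 - x2 * x3.

Lemma sigma_dd : sigma dd = dd.
Proof.
rewrite /dd !(rmorphB, rmorphM, rmorphXn, rmorph_nat) /= sigma_x1 sigma_x2 sigma_x3.
ring.
Qed.

(** [sigma] is the identity plus [Delta], so this is the binomial expansion of [(1 + Delta)^m]. *)
Lemma sigma_iterE m f :
  iter m (@sigma k) f = \sum_(j < m.+1) DeltaN j f *+ 'C(m, j).
Proof.
elim: m => [|m IH]; first by rewrite big_ord1.
rewrite iterS IH [RHS]big_ord_recl /= bin0 mulr1n rmorph_sum /=.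
under eq_bigr => j _.
  rewrite rmorphMn /= -[sigma _](subrK (DeltaN j f)) -/(Delta _) mulrnDl.
  rewrite -[Delta _]/(DeltaN j.+1 f); over.
(* Pascal's rule splits the right-hand side into the two sums produced by [sigma]. *)
under [in RHS]eq_bigr => j _ do rewrite /bump /= add1n binS mulrnDr.
rewrite !big_split /= addrC [RHS]addrA; congr (_ + _).
rewrite [LHS]big_ord_recl [in RHS]big_ord_recr /= (bin_small (ltnSn m)) mulr0n addr0 bin0 mulr1n.
by congr (_ + _); apply: eq_bigr => j _; rewrite /bump /= add1n.
Qed.

Variable p : nat.
Hypotheses (p_pr : prime p) (p_odd : odd p) (pk : p \in [pchar k]).

Lemma pchar_poly3 : p \in [pchar poly3].
Proof. exact: (rmorph_pchar (@mpolyC 3 k)). Qed.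

Lemma p_gt2 : (2 < p)%N.
Proof. by case: p p_pr p_odd => [|[|[|]]]. Qed.

(** In characteristic [p] the middle binomial coefficients vanish, so
    [(1 + Delta)^p = 1 + Delta^p]. *)
Lemma sigma_iter_p f : iter p (@sigma k) f = f + DeltaN p f.
Proof.
rewrite sigma_iterE big_ord_recr /= binn mulr1n; congr (_ + _).
rewrite (bigD1 (Ordinal (prime_gt0 p_pr))) //= big1 ?addr0 ?bin0 //.
move=> [j jp]; rewrite -val_eqE /= => j0; rewrite -mulr_natr.
have : (p %| 'C(p, j))%N by rewrite prime_dvd_bin // lt0n j0.
by rewrite (dvdn_pcharf pchar_poly3) => /eqP->; rewrite mulr0.
Qed.

Lemma Delta0 : Delta 0 = 0 :> poly3.
Proof. by rewrite /Delta rmorph0 subrr. Qed.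

Lemma DeltaN_0 m : DeltaN m 0 = 0 :> poly3.
Proof. by rewrite /DeltaN; elim: m => //= m ->; rewrite Delta0. Qed.

Lemma DeltaN_add m m' f : DeltaN (m + m') f = DeltaN m (DeltaN m' f) :> poly3.
Proof. by rewrite /DeltaN iterD. Qed.

Lemma DeltaN_ge m m' f : (m <= m')%N -> DeltaN m f = 0 -> DeltaN m' f = 0 :> poly3.
Proof. by move=> mm' f0; rewrite -(subnK mm') DeltaN_add f0 DeltaN_0. Qed.

Lemma Delta_x3 : Delta x3 = 0.
Proof. by rewrite /Delta sigma_x3 subrr. Qed.
Lemma Delta_x2 : Delta x2 = x3.
Proof. by rewrite /Delta sigma_x2; ring. Qed.
Lemma Delta_x1 : Delta x1 = x2.
Proof. by rewrite /Delta sigma_x1; ring. Qed.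

(** [sigma^p] is a ring morphism, so the constants and the variables suffice; [Delta^3] kills the
    variables, and [p >= 3]. *)
Lemma sigma_iter_p_id f : iter p (@sigma k) f = f.
Proof.
have iC a m : iter m (@sigma k) a%:MP = a%:MP by elim: m => //= m ->; rewrite sigmaC.
have i3 g : DeltaN 3 g = 0 -> iter p (@sigma k) g = g.
  by move=> /(DeltaN_ge p_gt2) e; rewrite sigma_iter_p e addr0.
elim/mpoly3_ind: f => [a||||f g Pf Pg|f g Pf Pg].
- exact: iC.
- by apply: i3; rewrite /DeltaN /= Delta_x1 Delta_x2 Delta_x3.
- by apply: i3; rewrite /DeltaN /= Delta_x2 Delta_x3 Delta0.
- by apply: i3; rewrite /DeltaN /= Delta_x3 !Delta0.
- rewrite -[RHS]/(f + g) -{2}Pf -{2}Pg.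
  by elim: p => //= m ->; rewrite rmorphD.
- rewrite -{2}Pf -{2}Pg.
  by elim: p => //= m ->; rewrite rmorphM.
Qed.

Lemma DeltaN_p f : DeltaN p f = 0 :> poly3.
Proof. by apply: (addrI f); rewrite -sigma_iter_p sigma_iter_p_id addr0. Qed.

(** As [sigma^p] is the identity, [sigma] permutes the factors cyclically. *)
Lemma sigma_Nx1 : sigma (Nx1 k p) = Nx1 k p.
Proof.
rewrite /Nx1 rmorph_prod /=.
have := sigma_iter_p_id x1; case: p p_pr => [//|m] _ im.
rewrite big_ord_recr [RHS]big_ord_recl /= -iterS im mulrC.
by congr (_ * _); apply: eq_bigr.
Qed.
End Setup.

Lemma rmorph_poly_ext (A B : nzRingType) (g h : {rmorphism {poly A} -> B}) :
  (forall a, g a%:P = h a%:P) -> g 'X = h 'X -> g =1 h.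
Proof.
move=> gC gX G; elim/poly_ind: G => [|G a IH]; first by rewrite !rmorph0.
by rewrite !rmorphD !rmorphM /= IH gC gX.
Qed.

(** Used with [K] the fraction field of [k[y, d]]: the substitution [x1 = (t^2 - y t - d) / (2 y)],
    [x2 = t], [x3 = y] sends [dd] back to [d]. *)
Lemma discriminant_identity (K : fieldType) (y d : K) : 2%:R * y != 0 ->
  'X^2 - 2%:R * ((2%:R * y)^-1%:P * ('X^2 - y%:P * 'X - d%:P)) * y%:P - 'X * y%:P = d%:P.
Proof.
move=> y0; set Q := 'X^2 - _ - _; rewrite -polyC_natr.
have -> (a b c : K) : a%:P * (b%:P * Q) * c%:P = (a * c * b)%:P * Q.
  by rewrite !polyCM; ring.
by rewrite divff // polyC1 mul1r /Q; ring.
Qed.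

(** * Inverting x3 *)

Section Gamma.
Variable k : fieldType.
Notation poly3 := {mpoly k[3]}.
Notation x1 := (x1 k).
Notation x2 := (x2 k).
Notation x3 := (x3 k).
Notation R := {poly {poly k}}.
Implicit Types f g h : poly3.
Implicit Types G H : {poly R}.

(* [{poly R}] is [k[y, d, t]] with [t] outermost; [gam] sends [y, d, t] to [x3, dd, x2]. *)
Definition gam1 : {poly k} -> poly3 := polyev (@mpolyC 3 k) x3.
HB.instance Definition _ := GRing.RMorphism.on gam1.
Definition gam2 : R -> poly3 := polyev gam1 (dd k).
HB.instance Definition _ := GRing.RMorphism.on gam2.
Definition gam : {poly R} -> poly3 := polyev gam2 x2.
HB.instance Definition _ := GRing.RMorphism.on gam.

Definition yy : R := 'X%:P.

Lemma gamX : gam 'X = x2. Proof. exact: polyevX. Qed.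

Lemma gamC a : gam a%:P = gam2 a. Proof. exact: polyevC. Qed.

Lemma gam2_polyC (a : {poly k}) : gam2 a%:P = gam1 a. Proof. exact: polyevC. Qed.
Lemma gam1C a : gam1 a%:P = a%:MP. Proof. exact: polyevC. Qed.
Lemma gam1X : gam1 'X = x3. Proof. exact: polyevX. Qed.

Lemma gam_yy : gam yy%:P = x3.
Proof. by rewrite gamC gam2_polyC gam1X. Qed.

Lemma gam2C a : gam2 a%:P%:P = a%:MP.
Proof. by rewrite gam2_polyC gam1C. Qed.

Lemma gam2X : gam2 'X = dd k.
Proof. exact: polyevX. Qed.

Lemma yy_neq0 : yy != 0.
Proof. by rewrite polyC_eq0 polyX_eq0. Qed.

Lemma sigma_gam2 a : sigma (gam2 a) = gam2 a.
Proof.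
elim/poly_ind: a => [|a b IH]; first by rewrite !rmorph0.
rewrite !rmorphD !rmorphM /= IH gam2X sigma_dd gam2_polyC; congr (_ + _).
elim/poly_ind: b => [|b u IHb]; first by rewrite !rmorph0.
by rewrite !rmorphD !rmorphM /= IHb gam1X sigma_x3 gam1C sigmaC.
Qed.

(** The coefficients map to invariants, and [sigma] adds [x3] to [x2], the image of the outer
    variable. *)
Lemma gam_shift G : gam (G \Po ('X + yy%:P)) = sigma (gam G).
Proof.
elim/poly_ind: G => [|G a IH]; first by rewrite comp_poly0 !rmorph0.
rewrite comp_polyD comp_polyM comp_polyX comp_polyC !rmorphD !rmorphM /= IH.
by rewrite rmorphD /= gam_yy gamX gamC sigma_x2 sigma_gam2.
Qed.

Lemma gam_pdelta G : gam (pdelta yy G) = Delta (gam G).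
Proof. by rewrite /pdelta rmorphB /= gam_shift. Qed.

Lemma gam_iter_pdelta m G : gam (iter m (pdelta yy) G) = DeltaN m (gam G).
Proof. by rewrite /DeltaN; elim: m => //= m <-; rewrite gam_pdelta. Qed.

Lemma gam_lcancel e a G H :
  gam (lcancel (yy ^+ e) a G H) = x3 ^+ e * gam G - gam2 a * gam H.
Proof.
by rewrite [LHS]polyev_lcancel /= rmorphXn /= -[gam2 yy]gamC gam_yy.
Qed.

Hypothesis two_neq0 : 2%:R != 0 :> k.

Lemma two_neq0_frac : 2%:R != 0 :> {fraction R}.
Proof.
have -> : 2%:R = tofrac (2%:R%:P%:P : R) by rewrite !rmorph_nat.
by rewrite tofrac_eq0 !polyC_eq0.
Qed.

(* The substitution inverse to [gam] after inverting [x3]. *)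
Definition gam_inv : poly3 -> {poly {fraction R}} :=
  mmap (polyC \o @tofrac R \o polyC \o polyC)
    (tnth [tuple (2%:R * tofrac yy)^-1%:P * ('X^2 - (tofrac yy)%:P * 'X - (tofrac 'X)%:P);
                 'X; (tofrac yy)%:P]).
HB.instance Definition _ := GRing.RMorphism.on gam_inv.

Lemma gam_invC a : gam_inv a%:MP = (tofrac a%:P%:P)%:P.
Proof. exact: mmapC. Qed.
Lemma gam_inv1 : gam_inv x1 =
  (2%:R * tofrac yy)^-1%:P * ('X^2 - (tofrac yy)%:P * 'X - (tofrac 'X)%:P).
Proof. by rewrite /gam_inv mmapX mmap1U. Qed.
Lemma gam_inv2 : gam_inv x2 = 'X.
Proof. by rewrite /gam_inv mmapX mmap1U. Qed.
Lemma gam_inv3 : gam_inv x3 = (tofrac yy)%:P.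
Proof. by rewrite /gam_inv mmapX mmap1U. Qed.

Lemma gam_inv_dd : gam_inv (dd k) = (tofrac 'X)%:P.
Proof.
rewrite /dd !(rmorphB, rmorphM, rmorphXn, rmorph_nat) /= gam_inv1 gam_inv2 gam_inv3.
apply: discriminant_identity.
by rewrite mulf_neq0 ?two_neq0_frac // tofrac_eq0 yy_neq0.
Qed.

(** Both sides are ring morphisms; they are compared one variable at a time, from the outermost
    inwards. *)
Lemma gamK G : gam_inv (gam G) = map_poly (@tofrac R) G.
Proof.
apply: (rmorph_poly_ext (g := gam_inv \o gam) (h := map_poly (@tofrac R))) => [a|]; last first.
  by rewrite /= gamX gam_inv2 map_polyX.
rewrite /= map_polyC /= gamC.
apply: (rmorph_poly_ext (g := gam_inv \o gam2) (h := polyC \o @tofrac R)) => [b|]; last first.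
  by rewrite /= gam2X gam_inv_dd.
apply: (rmorph_poly_ext (g := gam_inv \o gam2 \o polyC) (h := polyC \o @tofrac R \o polyC)) => [c|].
  by rewrite /= gam2C gam_invC.
by rewrite /= gam2_polyC gam1X gam_inv3.
Qed.

(** Composing [gam] with [gam_inv] gives an injective map; thus [x3], [dd], [x2] are algebraically
    independent. *)
Lemma gam_eq0 G : gam G = 0 -> G = 0.
Proof.
move=> G0; have tofrac_inj : injective (@tofrac R).
  by move=> a b /eqP; rewrite tofrac_eq => /eqP.
apply: (map_inj_poly tofrac_inj (rmorph0 _)).
by rewrite -gamK G0 rmorph0 map_poly0.
Qed.

(* [2 x1 x3 = x2^2 - x2 x3 - d] *)
Lemma gam_x1 :
  x3 * x1 = gam (2%:R^-1%:P%:P%:P * ('X^2 - yy%:P * 'X - 'X%:P)).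
Proof.
rewrite rmorphM !rmorphB rmorphXn rmorphM /= gamX gam_yy !gamC gam2C gam2X /dd.
have -> : x2 ^+ 2 - x3 * x2 - (x2 ^+ 2 - 2%:R * x1 * x3 - x2 * x3) = 2%:R * (x3 * x1).
  by ring.
by rewrite -(rmorph_nat (@mpolyC 3 k) 2) mulrA -rmorphM /= mulVf // mpolyC1 mul1r.
Qed.

(** Only [x1] needs a denominator, and one factor [x3] clears it; sums are brought to a common
    denominator. *)
Lemma gam_clear f : exists E G, x3 ^+ E * f = gam G.
Proof.
elim/mpoly3_ind: f => [a||||f g [E [G e]] [F [H e']]|f g [E [G e]] [F [H e']]].
- by exists 0%N, a%:P%:P%:P; rewrite mul1r gamC gam2C.
- by exists 1%N; eexists; apply: gam_x1.
- by exists 0%N, 'X; rewrite mul1r gamX.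
- by exists 0%N, yy%:P; rewrite mul1r gam_yy.
- exists (E + F)%N, (yy%:P ^+ F * G + yy%:P ^+ E * H).
  by rewrite rmorphD !rmorphM !rmorphXn /= gam_yy -e -e' exprD; ring.
- by exists (E + F)%N, (G * H); rewrite rmorphM /= -e -e' exprD; ring.
Qed.

(** Degree in [t = x2] after inverting [x3]: the factor [x3 ^+ E] clears denominators, and the
    leading coefficient is invertible once [x3] is. *)
Definition tdeg f r := exists E e G, x3 ^+ E * f = gam G /\ lterm yy r e G.

Lemma tdegM f g r s : tdeg f r -> tdeg g s -> tdeg (f * g) (r + s).
Proof.
move=> [E [e [G [eG LG]]]] [E' [e' [G' [eG' LG']]]].
exists (E + E')%N, (e + e')%N, (G * G'); split; last exact: lterm_mul.
by rewrite rmorphM /= -eG -eG' exprD; ring.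
Qed.

Lemma tdeg1 : tdeg 1 0.
Proof. by exists 0%N, 0%N, 1; rewrite rmorph1 mulr1; split=> //; apply: lterm1. Qed.

Lemma tdegX f r m : tdeg f r -> tdeg (f ^+ m) (r * m).
Proof.
move=> df; elim: m => [|m IH]; first by rewrite muln0; apply: tdeg1.
by rewrite exprS mulnS; apply: tdegM.
Qed.

Lemma tdeg_x2 : tdeg x2 1.
Proof. by exists 0%N, 0%N, 'X; rewrite gamX mul1r; split=> //; apply: ltermX. Qed.

Lemma tdeg_x1 : tdeg x1 2.
Proof.
exists 1%N, 0%N; eexists; split; first exact: gam_x1.
have -> : 'X^2 - yy%:P * 'X - 'X%:P = 'X * ('X - yy%:P) - 'X%:P :> {poly R} by ring.
set Q := 'X * _.
have sQ : size Q = 3%N.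
  by rewrite size_mul ?size_polyX ?size_XsubC ?polyX_eq0 ?polyXsubC_eq0.
have sX : (size (- ('X : R)%:P) < size Q)%N.
  by rewrite sQ size_polyN (leq_ltn_trans (size_polyC_leq1 _)).
have h0 : (2%:R^-1 : k)%:P%:P != 0 :> R by rewrite !polyC_eq0 invr_eq0.
split.
  by rewrite mul_polyC size_scale // size_polyDl.
exists ((2%:R^-1 : k)%:P%:P).
  by do 2!apply: rmorph_unit; rewrite unitfE invr_eq0.
rewrite lead_coefM lead_coefC lead_coefDl // /Q lead_coefM lead_coefX lead_coefXsubC.
by rewrite expr0 !mulr1.
Qed.

Lemma tdeg_sigma f r : tdeg f r -> tdeg (sigma f) r.
Proof.
move=> [E [e [G [eG LG]]]]; exists E, e, (G \Po ('X + yy%:P)).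
split; last exact: lterm_shift.
by rewrite gam_shift -eG rmorphM rmorphXn /= sigma_x3.
Qed.

Lemma sigma_x3X E : sigma (x3 ^+ E) = x3 ^+ E.
Proof. by rewrite rmorphXn /= sigma_x3. Qed.

Lemma tdeg_ker f r m : (r < m)%N -> tdeg f r -> DeltaN m f = 0.
Proof.
move=> rm [E [e [G [eG [sG _]]]]].
have : DeltaN m (x3 ^+ E * f) = 0.
  by rewrite eG -gam_iter_pdelta iter_pdelta_eq0 ?sG // rmorph0.
rewrite DeltaN_inv ?sigma_x3X // => /eqP; rewrite mulf_eq0 expf_eq0 (negPf (x3_neq0 k)) andbF /=.
by move/eqP.
Qed.

Variable p : nat.
Hypothesis pk : p \in [pchar k].

Lemma unit_nat_poly m : ~~ (p %| m)%N -> (m%:R : {poly k}) \is a GRing.unit.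
Proof.
rewrite (dvdn_pcharf pk) => m0; rewrite -(rmorph_nat (@polyC k)).
by apply: rmorph_unit; rewrite unitfE.
Qed.

Lemma unit_nat_poly2 m : ~~ (p %| m)%N -> (m%:R : R) \is a GRing.unit.
Proof.
move=> /unit_nat_poly m0; rewrite -(rmorph_nat (@polyC {poly k})).
exact: rmorph_unit.
Qed.

Lemma tdeg_DeltaN f r m :
    (forall j, r < j <= r + m -> ~~ (p %| j))%N ->
  tdeg f (r + m) -> tdeg (DeltaN m f) r.
Proof.
move=> pr [E [e [G [eG LG]]]]; exists E, (e + m)%N, (iter m (pdelta yy) G); split.
  by rewrite gam_iter_pdelta -eG DeltaN_inv ?sigma_x3X.
exact: (lterm_iter_pdelta yy_neq0 unit_nat_poly2 pr LG).
Qed.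

End Gamma.

(** * Reduction modulo x3 *)

Section NormExtension.
Variable k : fieldType.
Notation R := {poly {poly k}}.

(** A unit is a nonzero constant, so the product only has exponents [e + 2s], where its coefficient
    is a nonzero multiple of that of [q] at [s]. *)
Lemma coef_even_unit (q u : {poly k}) e t : u \is a GRing.unit ->
  (((q \Po 'X^2) * (u * 'X^e))`_t == 0) =
  [|| (t < e)%N, odd (t - e) | q`_((t - e)./2) == 0].
Proof.
rewrite poly_unitE => /andP[/size_poly1P[a a0 ->] _].
rewrite mulrA coefMXn; case: ltnP => et; first by rewrite eqxx.
rewrite coefMC mulf_eq0 (negPf a0) orbF coef_comp_poly_Xn // dvdn2 divn2 /=.
by case: odd; rewrite /= ?eqxx.
Qed.

Variables (p : nat) (N : R).
Hypotheses (sN : size N = p.+1) (mN : N \is monic) (p_gt0 : (0 < p)%N).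

(** The embedding of [k[x2^2, N]] into [k[x2][x1]]: the inner variable goes to its square, the outer
    one to [N]. *)
Definition evN (c : R) : R := map_poly (comp_poly 'X^2) c \Po N.
HB.instance Definition _ := GRing.RMorphism.copy evN
  (comp_poly N \o map_poly (comp_poly ('X^2 : {poly k}))).

Lemma comp_X2_inj : injective (comp_poly ('X^2 : {poly k})).
Proof.
move=> f g fg; apply/polyP => i.
have := congr1 (fun h : {poly k} => h`_(i * 2)) fg.
by rewrite !coef_comp_poly_Xn // !dvdn_mull // mulnK.
Qed.

Lemma size_evN c : (size (evN c)).-1 = ((size c).-1 * p)%N.
Proof.
by rewrite /evN size_comp_poly sN size_map_inj_poly //; [exact: comp_X2_inj | exact: rmorph0].
Qed.

Lemma lead_coef_evN c : lead_coef (evN c) = lead_coef c \Po 'X^2.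
Proof.
rewrite /evN lead_coef_comp ?sN ?ltnS // (monicP mN) expr1n mulr1.
by rewrite lead_coef_map_inj //; [exact: comp_X2_inj | exact: rmorph0].
Qed.

Lemma evN_eq0 c : (evN c == 0) = (c == 0).
Proof.
by rewrite -lead_coef_eq0 -[c == 0]lead_coef_eq0 lead_coef_evN (raddf_eq0 _ comp_X2_inj).
Qed.

(* At the top degree in the outer variable at most two terms survive, and the
   parities of their exponents in the inner variable differ. *)
Lemma evN_free (I : finType) (r e : I -> nat) (s c : I -> R) :
    (forall i, lterm 'X (r i) (e i) (s i)) -> (forall i, r i < p)%N ->
    (forall i j, r i = r j -> odd (e i) = odd (e j) -> i = j) ->
  \sum_i evN (c i) * s i = 0 -> forall i, c i = 0.
Proof.
move=> Ls rp inj sum0 i0; apply/eqP/negPn/negP => ci0.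
(* [D i] is the outer degree of the [i]-th term; as [r i < p], it determines [r i]. *)
pose D i := ((size (c i)).-1 * p + r i)%N.
have [i ci Dmax] := arg_maxnP (P := fun i => c i != 0) D ci0.
have sT j : c j != 0 -> size (evN (c j) * s j) = (D j).+1.
  move=> cj; have [sj _] := Ls j; have sj0 := lterm_neq0 (Ls j).
  rewrite size_mul ?evN_eq0 // sj addnS /= /D -size_evN -addSn prednK //.
  by rewrite lt0n size_poly_eq0 evN_eq0.
have DI j : D j = D i -> r j = r i.
  by move=> /(congr1 (modn^~ p)); rewrite /D !modnMDl !modn_small.
(* [t] is the inner degree of the leading coefficient of the chosen term. *)
pose t := ((size (lead_coef (c i))).-1.*2 + e i)%N.
have := congr1 (fun P : R => P`_(D i)`_t) sum0.
rewrite !coef0 coef_sum coef_sum (bigD1 i) //= [X in _ + X]big1 ?addr0 => [|j ji].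
  move/eqP; have -> : D i = (size (evN (c i) * s i)).-1 by rewrite sT.
  rewrite -lead_coefE lead_coefM lead_coef_evN; have [_ [u uu ->]] := Ls i.
  rewrite coef_even_unit // /t addnK odd_double doubleK -lead_coefE !lead_coef_eq0.
  by rewrite (negPf ci) orbF /= ltnNge leq_addl.
have [->|cj] := eqVneq (c j) 0; first by rewrite rmorph0 mul0r !coef0.
have := Dmax j cj; rewrite /= leq_eqVlt => /orP[/eqP Dji|Dji]; last first.
  by rewrite [_`_(D i)]nth_default ?coef0 // sT.
rewrite -Dji; have -> : D j = (size (evN (c j) * s j)).-1 by rewrite sT.
rewrite -lead_coefE lead_coefM lead_coef_evN; have [_ [u uu ->]] := Ls j.
apply/eqP; rewrite coef_even_unit //; case: ltnP => //= et.
suff -> : odd (t - e j) by [].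
(* Inner exponents in term [j] have the parity of [e j], while [t] has that of [e i]; equal outer
   degrees force [r j = r i], so these parities differ. *)
rewrite oddB // /t oddD odd_double /=.
have : odd (e i) != odd (e j) by apply: contraNneq ji => eij; apply/eqP/esym/inj; rewrite // DI.
by case: odd; case: odd.
Qed.

End NormExtension.

Section Rho.
Variable k : fieldType.
Notation poly3 := {mpoly k[3]}.
Notation x1 := (x1 k).
Notation x2 := (x2 k).
Notation x3 := (x3 k).
Notation R := {poly {poly k}}.
Implicit Types f g h : poly3.

(** Modulo [v], the morphism [s \o rho] fixes constants and variables, hence every polynomial. *)
Lemma rmorph_retract_ker (T : nzRingType) (rho : {rmorphism poly3 -> T})
    (s : {rmorphism T -> poly3}) (v : poly3) :
    (forall a, s (rho a%:MP) = a%:MP) ->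
    (exists g, x1 - s (rho x1) = v * g) -> (exists g, x2 - s (rho x2) = v * g) ->
    (exists g, x3 - s (rho x3) = v * g) ->
  forall f, rho f = 0 -> exists g, f = v * g.
Proof.
move=> sC s1 s2 s3 f f0; suff [g] : exists g, f - s (rho f) = v * g.
  by rewrite f0 rmorph0 subr0; exists g.
elim/mpoly3_ind: f {f0} => [a||||f g [f' ef] [g' eg]|f g [f' ef] [g' eg]] //.
- by exists 0; rewrite sC subrr mulr0.
- by exists (f' + g'); rewrite !rmorphD opprD addrACA ef eg mulrDr.
(* With [F], [G] the images of [f], [g] under [s \o rho]: [f g - F G = f (g - G) + (f - F) G]. *)
- exists (f * g' + f' * s (rho g)); rewrite !rmorphM mulrDr.
  rewrite [v * (f * g')]mulrCA -eg [v * (f' * _)]mulrA -ef.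
  by move: (s (rho f)) (s (rho g)) => a b; ring.
Qed.

(** Reduction modulo [x3], with [x1] as outer variable, so that [sigma] becomes the shift of the
    outer variable by [x2]. *)
Definition rho : poly3 -> R := mmap (polyC \o polyC) (tnth [tuple 'X; 'X%:P; 0]).
HB.instance Definition _ := GRing.RMorphism.on rho.

Lemma rhoC a : rho a%:MP = a%:P%:P. Proof. exact: mmapC. Qed.
Lemma rho_x1 : rho x1 = 'X. Proof. by rewrite /rho mmapX mmap1U. Qed.
Lemma rho_x2 : rho x2 = 'X%:P. Proof. by rewrite /rho mmapX mmap1U. Qed.
Lemma rho_x3 : rho x3 = 0. Proof. by rewrite /rho mmapX mmap1U. Qed.

(* Here the variables stand for the three generators of [A]. *)
Definition rhoA : poly3 -> R := mmap (polyC \o polyC) (tnth [tuple 0; 'X%:P; 'X]).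
HB.instance Definition _ := GRing.RMorphism.on rhoA.

Lemma rhoAC a : rhoA a%:MP = a%:P%:P. Proof. exact: mmapC. Qed.
Lemma rhoA_x1 : rhoA x1 = 0. Proof. by rewrite /rhoA mmapX mmap1U. Qed.
Lemma rhoA_x2 : rhoA x2 = 'X%:P. Proof. by rewrite /rhoA mmapX mmap1U. Qed.
Lemma rhoA_x3 : rhoA x3 = 'X. Proof. by rewrite /rhoA mmapX mmap1U. Qed.

Lemma rhoA_ker f : rhoA f = 0 -> exists g, f = x1 * g.
Proof.
apply: (rmorph_retract_ker (rho := rhoA) (s := polyev (polyev (@mpolyC 3 k) x2) x3)) => [a|||] /=.
- by rewrite rhoAC polyevC /= polyevC.
- by exists 1; rewrite rhoA_x1 rmorph0 subr0 mulr1.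
- by exists 0; rewrite rhoA_x2 polyevC /= polyevX subrr mulr0.
- by exists 0; rewrite rhoA_x3 polyevX subrr mulr0.
Qed.

Lemma rho_sigma f : rho (sigma f) = rho f \Po ('X + 'X%:P).
Proof.
apply: (rmorph3_ext (g := rho \o @sigma k) (h := comp_poly ('X + 'X%:P) \o rho)) => [a|||] /=.
- by rewrite sigmaC !rhoC comp_polyC.
- by rewrite sigma_x1 rmorphD /= rho_x1 rho_x2 comp_polyX.
- by rewrite sigma_x2 rmorphD /= rho_x2 rho_x3 addr0 comp_polyC.
- by rewrite sigma_x3 rho_x3 comp_poly0.
Qed.

Lemma rho_DeltaN m f : rho (DeltaN m f) = iter m (pdelta 'X) (rho f).
Proof. by rewrite /DeltaN; elim: m => //= m <-; rewrite rmorphB /= rho_sigma. Qed.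

(** The generators [x3], [dd], [Nx1] of [A] reduce to [0], [x2^2] and [rho (Nx1 k p)]. *)
Lemma rho_gensA p q : rho (comp_mpoly (gensA k p) q) = evN (rho (Nx1 k p)) (rhoA q).
Proof.
apply: (rmorph3_ext (g := rho \o comp_mpoly (gensA k p))
   (h := evN (rho (Nx1 k p)) \o rhoA)) => [a|||]; rewrite /=.
- by rewrite comp_mpolyC rhoC rhoAC /evN map_polyC /= !comp_polyC.
- by rewrite [comp_mpoly _ _]comp_mpolyXU rho_x3 rhoA_x1 rmorph0.
- rewrite [comp_mpoly _ _]comp_mpolyXU rhoA_x2 /evN map_polyC /= comp_polyX comp_polyC.
  rewrite !rmorphB rmorphXn !rmorphM /= rho_x2 rho_x3 !mulr0 !subr0.
  by rewrite expr2.
- by rewrite [comp_mpoly _ _]comp_mpolyXU rhoA_x3 /evN map_polyX comp_polyX.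
Qed.

(** Each factor reduces to a shift of the outer variable, which is monic of degree one. *)
Lemma rho_Nx1 p : size (rho (Nx1 k p)) = p.+1 /\ rho (Nx1 k p) \is monic.
Proof.
have H m : size (rho (iter m (@sigma k) x1)) = 2%N /\ rho (iter m (@sigma k) x1) \is monic.
  elim: m => [|m [sm mm]] /=; first by rewrite rho_x1 size_polyX monicX.
  by rewrite rho_sigma size_shift monicE lead_coef_shift.
rewrite /Nx1 rmorph_prod /=; split; last by apply: monic_prod => i _; case: (H i).
rewrite size_prod => [|i _]; last by rewrite monic_neq0 //; case: (H i).
under eq_bigr => i _ do rewrite (H i).1.
by rewrite sum_nat_const card_ord; lia.
Qed.

End Rho.

(** * The basis of the kernel *)

Section Main.
Variables (k : fieldType) (p n : nat).
Notation poly3 := {mpoly k[3]}.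
Notation x1 := (x1 k).
Notation x2 := (x2 k).
Notation x3 := (x3 k).
Notation R := {poly {poly k}}.
Hypotheses (p_pr : prime p) (p_odd : odd p) (pk : p \in [pchar k]).
Hypotheses (n_gt0 : (0 < n)%N) (n_le_p : (n <= p)%N).
Implicit Types f g h : poly3.

Notation I := ('I_n + 'I_n)%type.

Definition Sn (i : I) : poly3 :=
  match i with inl i => Mi k i | inr i => DeltaN (p - n) (Pi k p i) end.

(** Coefficients in [A] are given by polynomials in its three generators, so dividing by [x3] in [A]
    means dividing [q i] by the variable [x1]. *)
Definition comb (q : I -> poly3) := \sum_i comp_mpoly (gensA k p) (q i) * Sn i.

Let two_neq0 : 2%:R != 0 :> k.
Proof. by rewrite -(dvdn_pcharf pk) gtnNdvd // p_gt2. Qed.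

Lemma ndvd_lt j : (0 < j < p)%N -> ~~ (p %| j)%N.
Proof. by case/andP=> j0 jp; rewrite gtnNdvd. Qed.

Lemma ndvd_lt2 j : (p < j < p + p)%N -> ~~ (p %| j)%N.
Proof.
case/andP=> j0 jp; rewrite -(subnK (ltnW j0)) dvdn_addl //.
by apply: ndvd_lt; lia.
Qed.

Lemma tdeg_Mi i : tdeg (Mi k i) i.
Proof.
have e := odd_double_half i; rewrite /Mi; case: (odd i) e => /= e.
  rewrite [X in tdeg _ X](_ : i = 2 * i./2 + 1)%N; last by lia.
  by apply: tdegM; [apply: tdegX; apply: tdeg_x1 | apply: tdeg_x2].
rewrite [X in tdeg _ X](_ : i = 2 * i./2)%N; last by lia.
by apply: tdegX; apply: tdeg_x1.
Qed.

(** [x1] counts for two and [x2] for one; for even [i > 0], [Delta] lowers the degree [2p - i],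
    strictly between [p] and [2p], by one. *)
Lemma tdeg_Pi i : (i < p)%N -> tdeg (Pi k p i) ((p + p).-1 - i).
Proof.
move=> ip; have p2 := p_gt2 p_pr p_odd; rewrite /Pi; have [->|i0] := eqVneq i 0%N.
  rewrite (_ : _ - 0 = 2 * p.-1 + 1)%N; last by lia.
  by apply: tdegM; [apply: tdegX; apply: tdeg_x1 | apply: tdeg_x2].
have e := odd_double_half i; case: ifP => oi.
  rewrite (negPf oi) in e; apply: (@tdeg_DeltaN _ p pk (x1 ^+ (p - i./2)) _ 1).
    by move=> j ij; apply: ndvd_lt2; lia.
  rewrite (_ : _ + 1 = 2 * (p - i./2))%N; last by lia.
  by apply: tdegX; apply: tdeg_x1.
rewrite (_ : _ - i = 2 * (p - i.+1./2))%N; first by apply: tdegX; apply: tdeg_x1.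
have := odd_double_half i.+1; rewrite /= (negbFE oi) /=; lia.
Qed.

Definition degS (i : I) : nat := match i with inl i => i | inr i => p + n.-1 - i end.

(** The [p - n] differences applied to [P_i] act in degrees strictly between [p] and [2p], so each
    lowers the degree by one. *)
Lemma tdeg_Sn i : tdeg (Sn i) (degS i).
Proof.
case: i => i /=; first exact: tdeg_Mi.
have ni := ltn_ord i; apply: (tdeg_DeltaN pk) => [j ij|].
  by apply: ndvd_lt2; lia.
rewrite (_ : _ + _ = (p + p).-1 - i)%N; last by lia.
by apply: tdeg_Pi; lia.
Qed.

(** [M_i] has degree [i < n]; for the other elements the differences add up to [Delta^p = 0]. *)
Lemma Sn_ker i : DeltaN n (Sn i) = 0.
Proof.
case: i => i /=; last by rewrite -DeltaN_add subnKC // DeltaN_p.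
exact: (tdeg_ker (ltn_ord i) (tdeg_Mi i)).
Qed.

Lemma tdeg_Nx1 : tdeg (Nx1 k p) (2 * p).
Proof.
have H m : tdeg (iter m (@sigma k) x1) 2.
  by elim: m => [|m IH] /=; [exact: tdeg_x1 | exact: tdeg_sigma].
rewrite /Nx1; elim: p => [|m IH]; first by rewrite big_ord0 muln0; apply: tdeg1.
by rewrite big_ord_recr /= mulnS addnC; apply: tdegM.
Qed.

(** The degrees [0, ..., n-1] and [p, ..., p+n-1] are all residues modulo [2p] that are below [n]
    modulo [p]. *)
Lemma degS_onto d : (d %% p < n)%N -> exists i, degS i = (d %% (2 * p))%N.
Proof.
move=> dn; have p0 := prime_gt0 p_pr; set r := (d %% (2 * p))%N.
have rp : (r < 2 * p)%N by rewrite ltn_mod muln_gt0.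
have dr : (d %% p = r %% p)%N by rewrite /r modn_dvdm // dvdn_mull.
rewrite {}dr in dn; case: (ltnP r p) => pr.
  rewrite modn_small // in dn; by exists (inl (Ordinal dn)).
have rn : (r - p < n)%N.
  rewrite -(modn_small (m := (r - p)%N) (d := p)); last by lia.
  by rewrite -(modnDr (r - p)) subnK.
(* Degrees in the second family decrease with the index, hence the reversal. *)
have jn : (n.-1 - (r - p) < n)%N by lia.
by exists (inr (Ordinal jn)) => /=; lia.
Qed.

(** * Combinations of [S_n] over [A], and generation up to powers of [x3] *)

Lemma combD q q' : comb (fun i => q i + q' i) = comb q + comb q'.
Proof. by rewrite -big_split; apply: eq_bigr => i _; rewrite rmorphD mulrDl. Qed.

Lemma combM a q : comb (fun i => a * q i) = comp_mpoly (gensA k p) a * comb q.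
Proof. by rewrite mulr_sumr; apply: eq_bigr => i _; rewrite rmorphM mulrA. Qed.

Lemma comb1 i0 : comb (fun i => (i == i0)%:R) = Sn i0.
Proof.
rewrite /comb (bigD1 i0) //= eqxx rmorph1 mul1r big1 ?addr0 // => i ii0.
by rewrite (negPf ii0) rmorph0 mul0r.
Qed.

Lemma gensA_x1 : comp_mpoly (gensA k p) x1 = x3. Proof. exact: comp_mpolyXU. Qed.
Lemma gensA_x2 : comp_mpoly (gensA k p) x2 = dd k. Proof. exact: comp_mpolyXU. Qed.
Lemma gensA_x3 : comp_mpoly (gensA k p) x3 = Nx1 k p. Proof. exact: comp_mpolyXU. Qed.

(** Coefficients of powers of [t] lie in [k[x3, dd]], which is contained in [A]. *)
Lemma gam2_gensA a : exists q, gam2 a = comp_mpoly (gensA k p) q.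
Proof.
elim/poly_ind: a => [|a b [q IH]]; first by exists 0; rewrite !rmorph0.
have [q' eq'] : exists q, gam1 b = comp_mpoly (gensA k p) q.
  elim/poly_ind: b => [|b c [q' IHb]]; first by exists 0; rewrite !rmorph0.
  exists (q' * x1 + c%:MP).
  by rewrite !rmorphD !rmorphM /= IHb gam1X gam1C gensA_x1 comp_mpolyC.
exists (q * x2 + q').
by rewrite !rmorphD !rmorphM /= IH gam2X gam2_polyC eq' gensA_x2.
Qed.

(* Cancel leading terms in [t] against [N^m * Sn i], up to a power of [x3]. *)
Lemma gam_ker_comb G : iter n (pdelta (yy k)) G = 0 ->
  exists E q, x3 ^+ E * gam G = comb q.
Proof.
have [m] := ubnP (size G); elim: m G => // m IH G sG dG.
have [->|G0] := eqVneq G 0.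
  exists 0%N, (fun _ => 0); rewrite rmorph0 mulr0 /comb big1 // => i _.
  by rewrite rmorph0 mul0r.
have [d sGd] : exists d, size G = d.+1.
  by exists (size G).-1; rewrite prednK // lt0n size_poly_eq0.
have unat := unit_nat_poly2 pk.
have [i di] := degS_onto (ker_pdelta_degree (yy_neq0 k) unat n_le_p sGd dG).
(* The norm has degree [2p], so this power raises the degree of [Sn i] from [d %% (2 * p)] to
   [d]. *)
pose B := Nx1 k p ^+ (d %/ (2 * p)) * Sn i.
have : tdeg B d.
  rewrite [X in tdeg _ X](divn_eq d (2 * p)) -di mulnC.
  by apply: tdegM; [apply: tdegX; apply: tdeg_Nx1 | apply: tdeg_Sn].
have sB : sigma (Nx1 k p ^+ (d %/ (2 * p))) = Nx1 k p ^+ (d %/ (2 * p)).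
  by rewrite rmorphXn /= sigma_Nx1.
have kB : DeltaN n B = 0 by rewrite /B DeltaN_inv // Sn_ker mulr0.
case=> E' [e [H [eH [sH [u uu lH]]]]].
have dH : iter n (pdelta (yy k)) H = 0.
  apply: (gam_eq0 two_neq0); rewrite gam_iter_pdelta -eH DeltaN_inv ?sigma_x3X //.
  by rewrite kB mulr0.
(* Both scaled polynomials have leading coefficient [yy ^+ e * lead_coef G]; only the unit [u] is
   divided out. *)
have [E [q eq]] : exists E q,
    x3 ^+ E * gam (lcancel (yy k ^+ e) (lead_coef G / u) G H) = comb q.
  apply: IH; last by rewrite iter_pdelta_lcancel dG dH /lcancel !mulr0 subrr.
  apply: (leq_ltn_trans (size_lcancel sGd sH _)); last by rewrite -ltnS -sGd.
  by rewrite lH mulrA divrK // mulrC.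
have [a ea] := gam2_gensA (lead_coef G / u).
(* Inside coefficients the variables [x1] and [x3] stand for the generators [x3] and [Nx1]. *)
exists (E + e)%N, (fun j => q j + x1 ^+ E * a * x1 ^+ E' * x3 ^+ (d %/ (2 * p)) * (j == i)%:R).
rewrite combD -eq combM comb1 !rmorphM !rmorphXn /= gensA_x1 gensA_x3 -ea.
rewrite gam_lcancel -eH.
by rewrite /B exprD; move: (Nx1 k p ^+ _) (gam2 _) (gam G) => N a' g; ring.
Qed.

(** * Leading terms of [S_n] modulo [x3] *)

Lemma lterm_rho_x1X m : lterm 'X m 0 (rho (x1 ^+ m)).
Proof.
by rewrite rmorphXn /= rho_x1 -[X in lterm _ X](mul1n m) -(mul0n m); apply: lterm_exp (ltermX _).
Qed.

Lemma lterm_rho_x2 : lterm 'X 0 1 (rho x2).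
Proof.
rewrite rho_x2; split; first by rewrite size_polyC polyX_eq0.
by exists 1; rewrite ?unitr1 // lead_coefC mul1r.
Qed.

Lemma lterm_rho_x1x2 m : lterm 'X m 1 (rho (x1 ^+ m * x2)).
Proof.
rewrite rmorphM -[X in lterm _ X]addn0 -[X in lterm _ _ X]add0n.
exact: lterm_mul (lterm_rho_x1X m) lterm_rho_x2.
Qed.

Lemma lterm_rho_Pi i : (i < p)%N -> lterm 'X (p.-1 - i./2) (~~ odd i) (rho (Pi k p i)).
Proof.
move=> ip; have p2 := p_gt2 p_pr p_odd; rewrite /Pi; have [->|i0] := eqVneq i 0%N.
  by rewrite subn0; apply: lterm_rho_x1x2.
have e := odd_double_half i; case: (odd i) e => /= e.
  rewrite (_ : p.-1 - i./2 = p - i.+1./2)%N; first exact: lterm_rho_x1X.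
  by have := odd_double_half i.+1; rewrite /= uphalfE /=; lia.
rewrite -[Delta _]/(DeltaN 1 _) rho_DeltaN.
apply: (lterm_pdelta (negbT (polyX_eq0 k)) (unit_nat_poly pk)); first by apply: ndvd_lt; lia.
rewrite (_ : (p.-1 - i./2).+1 = p - i./2)%N; first exact: lterm_rho_x1X.
by lia.
Qed.

(** [rR] and [eR] are the exponents of [x1] and [x2] in the leading term of [rho (Sn i)]; each
    difference trades one [x1] for one [x2]. *)
Definition rR (i : I) : nat := match i with inl i => i./2 | inr i => n.-1 - i./2 end.
Definition eR (i : I) : nat :=
  match i with inl i => odd i | inr i => ~~ odd i + (p - n) end.

Lemma lterm_rho_Sn i : lterm 'X (rR i) (eR i) (rho (Sn i)).
Proof.
case: i => i /=.
  rewrite /Mi; case: odd => /=; [exact: lterm_rho_x1x2 | exact: lterm_rho_x1X].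
have ni := ltn_ord i; have e := odd_double_half i; rewrite rho_DeltaN.
apply: (lterm_iter_pdelta (negbT (polyX_eq0 k)) (unit_nat_poly pk)) => [j ij|].
  by apply: ndvd_lt; lia.
rewrite (_ : _ + _ = p.-1 - i./2)%N; last by lia.
by apply: lterm_rho_Pi; lia.
Qed.

Lemma rR_lt i : (rR i < p)%N.
Proof. by case: i => i /=; have := ltn_ord i; have := odd_double_half i; lia. Qed.

Lemma half_odd_inj (i j : 'I_n) : i./2 = j./2 -> odd i = odd j -> i = j.
Proof. by move=> h o; apply: val_inj; rewrite /= -[LHS]odd_double_half h o odd_double_half. Qed.

(** Halves of two numbers at most [n - 1] sum to [n - 1] only if both equal [n - 1] and are even.
    Then [n] is odd, [p - n] is even, and the exponents of [x2] differ in parity. *)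
Lemma rR_cross (i j : 'I_n) : i./2 = (n.-1 - j./2)%N ->
  odd (odd i) = odd (~~ odd j + (p - n)) -> False.
Proof.
move=> h; have ni := ltn_ord i; have nj := ltn_ord j.
have ei := odd_double_half i; have ej := odd_double_half j.
have oi : odd i = false by case: (odd i) ei => //= ei; lia.
have oj : odd j = false by case: (odd j) ej => //= ej; lia.
have en : n = i.+1 by rewrite oi oj /= in ei ej; lia.
by rewrite oi oj oddD oddB // p_odd en /= oi.
Qed.

Lemma rR_eR_inj i j : rR i = rR j -> odd (eR i) = odd (eR j) -> i = j.
Proof.
case: i j => [i|i] [j|j] /=.
- by rewrite !oddb => h o; congr inl; apply: half_odd_inj.
- by move=> h o; case: (rR_cross h o).
- by move=> h o; case: (rR_cross (esym h) (esym o)).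
- move=> h o; congr inr; apply: half_odd_inj.
    have := ltn_ord i; have := ltn_ord j.
    have := odd_double_half i; have := odd_double_half j; lia.
  by move: o; rewrite !oddD !oddb => /addIb/negb_inj.
Qed.

(** Modulo [x3] this is a relation with coefficients in [k[x2^2, N]], so [evN_free] kills every
    coefficient modulo [x3]. *)
Lemma comb_saturated q g : comb q = x3 * g -> exists q', forall i, q i = x1 * q' i.
Proof.
move=> eq; apply: (fin_all_exists (P := fun i h => q i = x1 * h)) => i; apply: rhoA_ker.
have [sN mN] := rho_Nx1 k p.
apply: (evN_free sN mN (prime_gt0 p_pr) (c := fun i => rhoA (q i))
  lterm_rho_Sn rR_lt rR_eR_inj).
transitivity (rho (comb q)); last by rewrite eq rmorphM /= rho_x3 mul0r.
by rewrite rmorph_sum; apply: eq_bigr => j _; rewrite rmorphM /= rho_gensA.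
Qed.

Lemma comb_x1 q q' : (forall i, q i = x1 * q' i) -> comb q = x3 * comb q'.
Proof.
by move=> e; rewrite -gensA_x1 -combM; apply: eq_bigr => i _; rewrite e.
Qed.

Lemma x1_neq0 : x1 != 0.
Proof. by rewrite -msupp_eq0 msuppX. Qed.

(** Descent on total degree: zero is divisible by [x3], so all coefficients are divisible by [x1],
    and the quotients satisfy the same relation. *)
Lemma comb_free q : comb q = 0 -> forall i, q i = 0.
Proof.
move=> q0; have [m qm] : exists m, forall i, (msize (q i) <= m)%N.
  by exists (\max_i msize (q i)) => i; apply: leq_bigmax.
elim: m q q0 qm => [|m IH] q q0 qm i.
  by apply/eqP; rewrite -msize_poly_eq0 -leqn0.
have [|q' eq'] := @comb_saturated q 0; first by rewrite mulr0.
have q'0 : comb q' = 0.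
  by apply: (mulfI (x3_neq0 k)); rewrite -(comb_x1 eq') q0 mulr0.
rewrite eq' (IH q') ?mulr0 // => j; have := qm j; rewrite eq'.
have [->|q'j] := eqVneq (q' j) 0; first by rewrite msize0.
by rewrite msizeM ?x1_neq0 // msizeX mdeg1.
Qed.

Lemma comb_desaturate E f q : x3 ^+ E * f = comb q -> exists q', f = comb q'.
Proof.
elim: E q => [|E IH] q; first by rewrite mul1r; exists q.
rewrite exprS -mulrA => e; have [q' eq'] := comb_saturated (esym e).
by apply: (IH q'); apply: (mulfI (x3_neq0 k)); rewrite e (comb_x1 eq').
Qed.

Lemma ker_comb f : DeltaN n f = 0 -> exists q, f = comb q.
Proof.
move=> f0; have [E [G eG]] := gam_clear two_neq0 f.
have dG : iter n (pdelta (yy k)) G = 0.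
  apply: (gam_eq0 two_neq0).
  by rewrite gam_iter_pdelta -eG DeltaN_inv ?sigma_x3X // f0 mulr0.
have [E' [q eq]] := gam_ker_comb dG.
by apply: (@comb_desaturate (E' + E) f q); rewrite exprD -mulrA eG.
Qed.

Lemma combE q : comb q =
  \sum_(i < n) comp_mpoly (gensA k p) (q (inl i)) * Mi k i +
  \sum_(i < n) comp_mpoly (gensA k p) (q (inr i)) * DeltaN (p - n) (Pi k p i).
Proof. by rewrite /comb big_sumType. Qed.

End Main.

Theorem theorem4p12 (p : nat) (k : fieldType) (n : nat) :
  prime p -> odd p -> p \in [pchar k] -> (1 <= n <= p)%N ->
  let B1 := fun i : 'I_n => Mi k i in
  let B2 := fun i : 'I_n => DeltaN (p - n) (Pi k p i) in
  (* the elements of S_n lie in K_n *)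
  (forall i : 'I_n, Kker n (B1 i) /\ Kker n (B2 i)) /\
  (* S_n generates K_n as an A-module *)
  (forall f : {mpoly k[3]}, Kker n f ->
     exists a b : 'I_n -> {mpoly k[3]},
       (forall i, inA p (a i)) /\ (forall i, inA p (b i)) /\
       f = \sum_(i < n) a i * B1 i + \sum_(i < n) b i * B2 i) /\
  (* S_n is A-linearly independent *)
  (forall a b : 'I_n -> {mpoly k[3]},
     (forall i, inA p (a i)) -> (forall i, inA p (b i)) ->
     \sum_(i < n) a i * B1 i + \sum_(i < n) b i * B2 i = 0 ->
     forall i, a i = 0 /\ b i = 0).
Proof.
move=> p_pr p_odd pk /andP[n_gt0 n_le_p] B1 B2; split; [|split].
- move=> i; have Sker := Sn_ker p_pr p_odd pk n_gt0 n_le_p.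
  by split; apply/eqP; [exact: (Sker (inl i)) | exact: (Sker (inr i))].
- move=> f /eqP/(ker_comb p_pr p_odd pk n_gt0 n_le_p)[q ->].
  exists (fun i => comp_mpoly (gensA k p) (q (inl i))).
  exists (fun i => comp_mpoly (gensA k p) (q (inr i))).
  by rewrite combE; split=> [i|]; [eexists | split=> // i; eexists].
- move=> a b /fin_all_exists[qa ea] /fin_all_exists[qb eb] e i.
  (* The chosen preimages of both coefficient families are glued into one family. *)
  pose q (j : 'I_n + 'I_n) := match j with inl j => qa j | inr j => qb j end.
  have q0 : comb p q = 0.
    rewrite combE -[RHS]e; congr (_ + _); apply: eq_bigr => j _ /=.
      by rewrite ea.
    by rewrite eb.
  have qz := comb_free p_pr p_odd pk n_gt0 n_le_p q0.
  by rewrite ea eb -[qa i]/(q (inl i)) -[qb i]/(q (inr i)) !qz rmorph0.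
Qed.
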